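(* Let $\mathcal{U}\subset 2^{\{1,\dots,n\}}$ be an admissible update set and let $u_k$, $k=1,2,\dots$, be a sequence of elements of $\mathcal{U}$. Suppose the index sequence can be partitioned into disjoint intervals $\{k_i,\dots,k_{i+1}-1\}$, $i=1,2,\dots$, with $k_i>k_{i-1}$, such that over each interval $\bigcup_{k\in\{k_i,\dots,k_{i+1}-1\}}u_k=\{1,\dots,n\}$, and suppose $N=\max_j (k_{j+1}-k_j+1)$ is finite. Let $D$ be a $\mathcal{U}$-feasible, compact subset of $\mathbb{R}^n$ and $C=\mathrm{conv}(D)$. Let $F_k$, $k=1,2,\dots$, be a sequence of $\mathcal{U}$-separable convex functions, $F_k(z)=\sum_{u\in\mathcal{U}}F_k^{(u)}(z^{[u]})$, where each $F_k^{(u)}:\mathbb{R}^{|u|}\to\mathbb{R}$ is convex with bounded curvature with curvature constant $\mu_F$. Let $\beta>0$ and let $\{z_k\}$ be a sequence of vectors with $z_1\in C$ satisfying $$x_k\in\arg\min_{x\in D}F_k^{(u_k)}\big(z_k^{[u_k]}+\beta(x^{[u_k]}-z_k^{[u_k]})\big),\qquad z_{k+1}=z_k+\beta\,U_{u_k}(x_k-z_k).$$ Suppose that $$\beta\le(1-\gamma)\gamma\min\Big\{\frac{\epsilon'}{N\mu_F\bar{x}_D^2},1\Big\}$$ with $0<\gamma<1$, $\epsilon'>0$, $\bar{x}_D:=\max_{y,z\in\mathrm{conv}(D)}\|y-z\|_2$, and that $$|F_{k+1}(z)-F_k(z)|\le\frac{\gamma_1\gamma}{2N}\beta\epsilon'\quad\text{for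 all } z\in C \text{ and all } k,$$ where $\gamma_1\in(0,\gamma/2)$. Then for all $k_i$ sufficiently large, $$F_{k_i}(z_{k_i})-F_{k_i}(y^*_{k_i})\le\epsilon:=(|\mathcal{U}|+1)\epsilon',$$ where $y_k^*\in\arg\min_{z\in C}F_k(z)$.
   Context: For $x\in\mathbb{R}^n$ and $u\subseteq\{1,\dots,n\}$, $x^{[u]}\in\mathbb{R}^{|u|}$ denotes the vector of the elements of $x$ indexed by $u$, and $U_u:\mathbb{R}^n\to\mathbb{R}^n$ is the map that keeps the elements of its argument indexed by $u$ and sets all other elements to $0$. Admissible update set: let $\bar{\mathcal{U}}\subset 2^{\{1,\dots,n\}}$ be a partition of $\{1,\dots,n\}$. A collection $\mathcal{U}\subset 2^{\{1,\dots,n\}}$ is an admissible update set if, for some such partition, $\mathcal{U}=\bar{\mathcal{U}}$ or $\mathcal{U}$ is $\bar{\mathcal{U}}$ together with the full set $\{1,\dots,n\}$. $\mathcal{U}$-feasible: $D\subset\mathbb{R}^n$ with $C=\mathrm{conv}(D)$ is $\mathcal{U}$-feasible if $z+U_u(x-z)\in C$ for all $z\in C$, $x\in D$, $u\in\mathcal{U}$. $\mathcal{U}$-separable: $h:\mathbb{R}^n\to\mathbb{R}$ is $\mathcal{U}$-separable if $h(z)=\sum_{u\in\mathcal{U}}h^{(u)}(z^{[u]})$ with $h^{(u)}:\mathbb{R}^{|u|}\to\mathbb{R}$. Bounded curvature: a convex function $h$ has bounded curvature on a set $S$ with curvature constant $\mu_h\ge 0$ if $h(z+\delta)-h(z)\le\partial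 h(z)^T\delta+\mu_h\|\delta\|_2^2$ for all $z,z+\delta\in S$, where $\partial h(z)$ denotes a (fixed choice of) subgradient of $h$ at $z$ and $\mu_h$ does not depend on $z,\delta$. For $F_k^{(u)}$ the set in question is $\{z^{[u]}:z\in C\}$. A quotient with zero denominator is read as $+\infty$.
   Formalization: When U is a partition together with the full set, F_k is taken as the sum over the partition's blocks only and the full set's component is F_k itself; with the sum over all of U the claim is false. When U is a partition nothing is changed. *)

(* Defs.v *)
(* MathComp / MathComp-Analysis. *)
From mathcomp Require Import all_boot all_order all_algebra.
From mathcomp Require Import all_classical all_reals all_analysis.

Set Implicit Arguments.
Unset Strict Implicit.
Unset Printing Implicit Defensive.
Import Order.TTheory GRing.Theory Num.Theory.
Import numFieldNormedType.Exports.

Local Open Scope classical_set_scope.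
Local Open Scope ring_scope.

Definition fullset n : {set 'I_n} := [set: 'I_n]%SET.

Definition is_max {d} {T : porderType d} (A : set T) (m : T) : Prop :=
  A m /\ ubound A m.

Section Definitions.
Context {R : realType}.

Definition argmin {T : Type} (A : set T) (f : T -> R) : set T :=
  [set x | A x /\ forall y, A y -> f x <= f y].

Section Vectors.
Context {n : nat}.
Implicit Types x y z : 'rV[R]_n.

Definition dotv x y : R := \sum_(i < n) x 0 i * y 0 i.

(* The library's norm on row vectors is the sup norm. *)
Definition norm2 x : R := Num.sqrt (dotv x x).

Definition conv_hull (D : set 'rV[R]_n) : set 'rV[R]_n :=
  smallest (@convex_set R 'rV[R]_n) D.

Definition subvec (u : {set 'I_n}) x : 'rV[R]_#|u| :=
  \row_(j < #|u|) x 0 (enum_val j).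

Definition keep (u : {set 'I_n}) x : 'rV[R]_n :=
  \row_(i < n) (if i \in u then x 0 i else 0).

(* [g] is a subgradient at [z] of the function [h], defined on all of R^n. *)
Definition subgradient (h : 'rV[R]_n -> R) z (g : 'rV[R]_n) : Prop :=
  forall y, h z + dotv g (y - z) <= h y.

Definition bounded_curvature (h : 'rV[R]_n -> R) (S : set 'rV[R]_n) (mu : R) :
    Prop :=
  0 <= mu /\
  exists2 dh : 'rV[R]_n -> 'rV[R]_n,
    forall z, S z -> subgradient h z (dh z)
  & forall z delta, S z -> S (z + delta) ->
      h (z + delta) - h z <= dotv (dh z) delta + mu * norm2 delta ^+ 2.

Definition U_feasible (U : {set {set 'I_n}}) (D : set 'rV[R]_n) : Prop :=
  forall z x u, conv_hull D z -> D x -> u \in U ->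
    conv_hull D (z + keep u (x - z)).

(* If U is itself a partition of the index set, then U is the only partition
   contained in U, and this says h z = \sum_(u in U) hu u (subvec u z).
   If U is a partition together with the full set, it contains two partitions,
   Ubar and {{1..n}}: the sum is over the blocks of Ubar, and the component of
   the full set, which a full update minimizes, is h itself. Summing over all
   of U instead would make separability void (take hu u = 0 off the full set)
   and would let an update ignore the part of h that it changes. *)
Definition U_separable (U : {set {set 'I_n}}) (h : 'rV[R]_n -> R)
    (hu : forall u : {set 'I_n}, 'rV[R]_#|u| -> R) : Prop :=
  forall P : {set {set 'I_n}}, P \subset U -> finset.partition P (fullset n) ->
    forall z, h z = \sum_(u in P) hu u (subvec u z).

End Vectors.
End Definitions.

Definition admissible n (U : {set {set 'I_n}}) : Prop :=
  exists2 Ubar : {set {set 'I_n}}, finset.partition Ubar (fullset n)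
    & U = Ubar \/ U = (fullset n |: Ubar)%SET.

(* Main.v *)
(* Write A_k = F_k(z_k) and d for the bound on the drift |F_{k+1} - F_k|. By
   bounded curvature and the minimality of x_k, updating the block v of z_k
   gives, for every y in C, a decrease of F_k of at least beta times the block
   gap F_k(z_k) - F_k(z_k + U_v(y - z_k)), up to e = mu beta^2 xbar^2.
   Taking y = z_k, A_k never grows by more than e + d. Over an interval of
   length L starting at s, take y = y*_s. Either a full update occurs, which
   removes a fraction beta of the gap at once; or every block of the partition
   is updated, and at its first update its gap is still the one at time s up to
   2 L d. By separability the block gaps sum to the gap of F_s, so in both cases
     gap(s + L) <= (1 - beta) gap(s) + L e + 2 L d + 2 beta |U| L d.
   The step size makes the last three terms less than beta (|U| + 1) eps', so
   the gaps eventually stay below (|U| + 1) eps'. *)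

Require Import Defs.
From mathcomp Require Import all_boot all_order all_algebra.
From mathcomp Require Import all_classical all_reals all_analysis.
From mathcomp Require Import ring lra.

Set Implicit Arguments.
Unset Strict Implicit.
Unset Printing Implicit Defensive.
Import Order.TTheory GRing.Theory Num.Theory.
Import numFieldNormedType.Exports.

Local Open Scope classical_set_scope.
Local Open Scope ring_scope.

(** * Convex hulls and induction on them *)

Section ConvexHull.
Context {R : realType} {n : nat}.
Implicit Types (A D : set 'rV[R]_n) (x y z : 'rV[R]_n).

Lemma convex_setP A :
  @convex_set R 'rV[R]_n A <->
  forall x y t, 0 <= t -> t <= 1 -> A x -> A y -> A (t *: x + (1 - t) *: y).
Proof.
split=> [cA x y t t0 t1 Ax Ay | cA x y t /set_mem Ax /set_mem Ay].
  exact: set_mem (cA x y (Itv01 t0 t1) (mem_set Ax) (mem_set Ay)).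
by rewrite inE; apply: cA.
Qed.

Lemma sub_conv_hull D x : D x -> conv_hull D x.
Proof. exact: sub_gen_smallest. Qed.

Lemma conv_hull_convex D x y t : 0 <= t -> t <= 1 ->
  conv_hull D x -> conv_hull D y -> conv_hull D (t *: x + (1 - t) *: y).
Proof.
move=> t0 t1 Dx Dy A [cA DA].
by apply: (convex_setP A).1 => //; [apply: Dx | apply: Dy].
Qed.

(** Lets a condition stable under convex combinations be checked on [D] only; it carries the
    linearized step bound and block feasibility over to the hull. *)
Lemma conv_hull_ind D A :
  (forall x, D x -> A x) ->
  (forall x y t, 0 <= t -> t <= 1 -> A x -> A y -> A (t *: x + (1 - t) *: y)) ->
  forall x, conv_hull D x -> A x.
Proof. by move=> DA cA; apply: smallest_sub => //; apply/convex_setP. Qed.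

End ConvexHull.

(** * Block restriction, Euclidean norm and separable functions *)

Section Blocks.
Context {R : realType} {n : nat}.
Implicit Types (x y z : 'rV[R]_n) (v w : {set 'I_n}) (P : {set {set 'I_n}}).

Lemma subvecD v x y : subvec v (x + y) = subvec v x + subvec v y.
Proof. by apply/rowP => i; rewrite !mxE. Qed.

Lemma subvecZ v a x : subvec v (a *: x) = a *: subvec v x.
Proof. by apply/rowP => i; rewrite !mxE. Qed.

Lemma subvecB v x y : subvec v (x - y) = subvec v x - subvec v y.
Proof. by apply/rowP => i; rewrite !mxE. Qed.

Lemma subvec_keep v x : subvec v (keep v x) = subvec v x.
Proof. by apply/rowP => i; rewrite !mxE enum_valP. Qed.

Lemma subvec_keep_disjoint v w x : [disjoint v & w]%B -> subvec w (keep v x) = 0.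
Proof.
move=> vw; apply/rowP => i; rewrite !mxE.
by rewrite (disjointFl vw) // enum_valP.
Qed.

Lemma keep0 v : keep v 0 = 0 :> 'rV[R]_n.
Proof. by apply/rowP => i; rewrite !mxE if_same. Qed.

Lemma keepZ v a x : keep v (a *: x) = a *: keep v x.
Proof. by apply/rowP => i; rewrite !mxE; case: ifP; rewrite ?mulr0. Qed.

Lemma keep_fullset x : keep (fullset n) x = x.
Proof. by apply/rowP => i; rewrite !mxE inE. Qed.

Lemma norm2_subvec_le v x : norm2 (subvec v x) <= norm2 x.
Proof.
rewrite /norm2 ler_wsqrtr // /dotv.
under eq_bigr do rewrite !mxE.
rewrite -(big_enum_val (fun i => x 0 i * x 0 i)) /=.
rewrite [leRHS](bigID (mem v)) /= lerDl sumr_ge0 // => i _.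
by rewrite -expr2 sqr_ge0.
Qed.

Lemma norm2_ge0 m (x : 'rV[R]_m) : 0 <= norm2 x.
Proof. exact: sqrtr_ge0. Qed.

Lemma dotvZr m (g x : 'rV[R]_m) a : dotv g (a *: x) = a * dotv g x.
Proof.
by rewrite /dotv mulr_sumr; apply: eq_bigr => i _; rewrite mxE mulrCA.
Qed.

Lemma dotvDr m (g x y : 'rV[R]_m) : dotv g (x + y) = dotv g x + dotv g y.
Proof.
by rewrite /dotv -big_split; apply: eq_bigr => i _; rewrite mxE mulrDr.
Qed.

Lemma norm2Z m a (x : 'rV[R]_m) : norm2 (a *: x) ^+ 2 = a ^+ 2 * norm2 x ^+ 2.
Proof.
have d0 k (y : 'rV[R]_k) : 0 <= dotv y y.
  by apply: sumr_ge0 => i _; rewrite -expr2 sqr_ge0.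
rewrite /norm2 !sqr_sqrtr // dotvZr /dotv !mulr_sumr.
by apply: eq_bigr => i _; rewrite mxE; ring.
Qed.

Section Separable.
Context (P : {set {set 'I_n}}) (h : 'rV[R]_n -> R)
  (hu : forall v : {set 'I_n}, 'rV[R]_#|v| -> R).
Context (partP : finset.partition P (fullset n))
  (sep : forall z, h z = \sum_(v in P) @hu v (subvec v z)).

Lemma partition_disjoint v w : v \in P -> w \in P -> v != w -> [disjoint v & w]%B.
Proof. by case/and3P: partP => _ /finset.trivIsetP tP _; apply: tP. Qed.

(** The blocks are disjoint, so changing block [v] leaves every other summand alone. *)
Lemma separable_replace v y z : v \in P ->
  h (z + keep v (y - z)) - h z = @hu v (subvec v y) - @hu v (subvec v z).
Proof.
move=> vP; rewrite !sep (bigD1 v) //= [X in _ - X](bigD1 v) //=.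
have -> : subvec v (z + keep v (y - z)) = subvec v y.
  by rewrite subvecD subvec_keep subvecB subrKC.
under eq_bigr => w /andP[wP wv].
  rewrite subvecD subvec_keep_disjoint ?addr0; last first.
    by rewrite partition_disjoint // eq_sym.
  over.
rewrite /=; lra.
Qed.

(** Each block gap involves its own summand only, so the gaps add up exactly, with no error term. *)
Lemma separable_sum y z :
  \sum_(v in P) (h z - h (z + keep v (y - z))) = h z - h y.
Proof.
under eq_bigr => v vP do
  rewrite -[_ - _]opprB (separable_replace _ _ vP) opprB.
by rewrite sumrB -!sep.
Qed.

End Separable.
End Blocks.

(** * Decrease of one block update *)

Section Step.
Context {R : realType} {n : nat} (D : set 'rV[R]_n) (X : R).
Context (diamX : forall y z, conv_hull D y -> conv_hull D z -> norm2 (y - z) <= X).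

(** A Frank-Wolfe step: bounded curvature majorizes [f] by its linearization plus a quadratic error,
    minimality of [x] allows comparison with any point of [D], and the subgradient inequality turns
    the linear term at [y] into a difference of values. *)
Lemma block_step (v : {set 'I_n}) (f : 'rV[R]_#|v| -> R) mu beta x y z :
  bounded_curvature f (subvec v @` conv_hull D) mu ->
  0 <= beta -> beta <= 1 -> conv_hull D z -> conv_hull D y ->
  argmin D (fun w => f (subvec v z +
              beta *: (subvec v w - subvec v z))) x ->
  f (subvec v z + beta *: (subvec v x - subvec v z)) - f (subvec v z) <=
    beta * (f (subvec v y) - f (subvec v z)) + mu * beta ^+ 2 * X ^+ 2.
Proof.
move=> [mu0 [df sg curv]] b0 b1 Cz Cy [_ xmin].
set T := f (_ + _).
set g := df (subvec v z).
have Sz : (subvec v @` conv_hull D) (subvec v z) by exists z.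
(* The bound is linear in [w], so it extends from [D] to the convex hull. *)
have T_le w : conv_hull D w -> T - f (subvec v z) <=
    beta * dotv g (subvec v w - subvec v z) + mu * beta ^+ 2 * X ^+ 2.
  move: w; apply: conv_hull_ind => [w Dw | w1 w2 t t0 t1].
    have Cw := sub_conv_hull Dw.
    have Sw : (subvec v @` conv_hull D)
        (subvec v z + beta *: (subvec v w - subvec v z)).
      (* The trial point is the block of a convex combination of [w] and [z], hence lies where the
         curvature is bounded. *)
      exists (beta *: w + (1 - beta) *: z); first exact: conv_hull_convex.
      rewrite -!subvecB -subvecZ -subvecD; congr subvec.
      by apply/rowP => i; rewrite !mxE; ring.
    apply: le_trans (lerD (xmin _ Dw) (lexx _)) _.
    apply: le_trans (curv _ _ Sz Sw) _.
    rewrite dotvZr norm2Z lerD2l mulrA ler_wpM2l ?mulr_ge0 ?sqr_ge0 //.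
    rewrite lerXn2r ?nnegrE ?norm2_ge0 //.
      exact: le_trans (norm2_ge0 _) (diamX Cz Cz).
    by rewrite -subvecB (le_trans (norm2_subvec_le _ _)) // diamX.
  move=> le1 le2.
  have -> : subvec v (t *: w1 + (1 - t) *: w2) - subvec v z =
      t *: (subvec v w1 - subvec v z) + (1 - t) *: (subvec v w2 - subvec v z).
    by apply/rowP => i; rewrite !mxE; ring.
  rewrite dotvDr !dotvZr.
  have t1' : 0 <= 1 - t by rewrite subr_ge0.
  have := ler_wpM2l t0 le1; have := ler_wpM2l t1' le2; nra.
apply: le_trans (T_le _ Cy) _; rewrite lerD2r ler_wpM2l //.
have := sg _ Sz (subvec v y); rewrite -/g; lra.
Qed.

End Step.

(** * Decrease over one covering interval *)

Section Sweep.
Context {R : realType} {n : nat} (C : set 'rV[R]_n) (F : nat -> 'rV[R]_n -> R)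
  (u : nat -> {set 'I_n}) (z : nat -> 'rV[R]_n) (beta e d : R) (s L : nat).
Context (beta0 : 0 <= beta) (beta1 : beta <= 1) (e0 : 0 <= e) (d0 : 0 <= d).
Context (Cz : forall j, (j <= L)%N -> C (z (s + j)%N)).
Context (step : forall j w, (j < L)%N -> C w ->
  F (s + j) (z (s + j).+1) - F (s + j) (z (s + j)%N) <=
    beta * (F (s + j) (z (s + j)%N + keep (u (s + j)) (w - z (s + j)%N)) -
            F (s + j) (z (s + j)%N)) + e).
Context (drift : forall j w, (j < L)%N -> C w ->
  `|F (s + j).+1 w - F (s + j) w| <= d).

Lemma drift_sweep j w : (j <= L)%N -> C w ->
  `|F (s + j) w - F s w| <= j%:R * d.
Proof.
elim: j => [|j IH] jL Cw; first by rewrite addn0 subrr normr0 mul0r.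
have := drift jL Cw; have := IH (ltnW jL) Cw.
rewrite addnS -natr1 !ler_norml; lra.
Qed.

Lemma drift_sweep_max j w : (j <= L)%N -> C w ->
  `|F (s + j) w - F s w| <= L%:R * d.
Proof.
move=> jL Cw; apply: le_trans (drift_sweep jL Cw) _.
by rewrite ler_wpM2r // ler_nat.
Qed.

Lemma step_drift j w : (j < L)%N -> C w ->
  F (s + j.+1) (z (s + j.+1)%N) <= F (s + j) (z (s + j)%N) +
    beta * (F (s + j) (z (s + j)%N + keep (u (s + j)) (w - z (s + j)%N)) -
            F (s + j) (z (s + j)%N)) + (e + d).
Proof.
move=> jL Cw; rewrite addnS.
have := step jL Cw; have := drift jL (Cz jL); rewrite addnS ler_norml; lra.
Qed.

Lemma step_mono j : (j < L)%N ->
  F (s + j.+1) (z (s + j.+1)%N) <= F (s + j) (z (s + j)%N) + (e + d).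
Proof.
move=> jL; have := step_drift jL (Cz (ltnW jL)).
by rewrite subrr keep0 addr0 subrr mulr0 addr0.
Qed.

Lemma sweep_mono i j : (i <= j)%N -> (j <= L)%N ->
  F (s + j) (z (s + j)%N) <= F (s + i) (z (s + i)%N) + (j - i)%:R * (e + d).
Proof.
elim: j => [|j IH] ij jL.
  by move: ij; rewrite leqn0 => /eqP ->; rewrite subnn mul0r addr0.
move: ij; rewrite leq_eqVlt => /orP[/eqP -> | ij].
  by rewrite subnn mul0r addr0.
have := step_mono jL; have := IH ij (ltnW jL).
rewrite subSn // -natr1; lra.
Qed.

(** The full update at step [j] contracts the gap by [1 - beta] up to [e + d], and [sweep_mono]
    covers the steps before and after it. Using [F s y] in place of [F (s + j) y] costs
    [beta * (L%:R * d)]. *)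
Lemma sweep_full y : C y -> (exists2 j, (j < L)%N & u (s + j) = fullset n) ->
  F (s + L) (z (s + L)%N) <= F s (z s) - beta * (F s (z s) - F s y) +
    L%:R * (e + d) + beta * (L%:R * d).
Proof.
move=> Cy [j jL uj].
have := sweep_mono jL (leqnn L).
have := sweep_mono (leq0n j) (ltnW jL); rewrite addn0 subn0.
have := step_drift jL Cy; rewrite uj keep_fullset subrKC.
have := drift_sweep_max (ltnW jL) Cy; rewrite ler_norml => /andP[_].
set A := F (s + j) (z _).
rewrite natrB // -natr1 => Fy Aj1 Aj AL.
have b1 : 0 <= 1 - beta by rewrite subr_ge0.
have h1 := ler_wpM2l b1 Aj.
have h2 := ler_wpM2l beta0 Fy.
(* Errors made before [j] are also damped by [1 - beta]; this gain is dropped. *)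
have h3 : 0 <= beta * (j%:R * (e + d)) by rewrite !mulr_ge0 // addr_ge0.
lra.
Qed.

Context (P : {set {set 'I_n}}) (partP : finset.partition P (fullset n)).
(** The summands may change with [j]: across different times only values of [F] itself are
    compared. *)
Context (sep : forall j, (j < L)%N ->
  exists hu : (forall v : {set 'I_n}, 'rV[R]_#|v| -> R),
    forall a, F (s + j) a = \sum_(v in P) hu v (subvec v a)).
Context (CP : forall v a b, v \in P -> C a -> C b -> C (a + keep v (b - a))).
Context (upd : forall j, (j < L)%N ->
  exists a, z (s + j).+1 = z (s + j)%N + keep (u (s + j)) a).
Context (uP : forall j, (j < L)%N -> u (s + j) \in P).

(** By separability at time [s + j], the block gap sees the iterate through block [v] alone, so
    [z s] may replace it; passing from [F (s + j)] to [F s] then costs [L%:R * d] at each of two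
    points. *)
Lemma block_gap_drift j v y : (j < L)%N -> v \in P -> C y ->
  subvec v (z (s + j)%N) = subvec v (z s) ->
  F s (z s) - F s (z s + keep v (y - z s)) - 2 * (L%:R * d) <=
  F (s + j) (z (s + j)%N) -
    F (s + j) (z (s + j)%N + keep v (y - z (s + j)%N)).
Proof.
move=> jL vP Cy same; have [hu hsep] := sep jL.
have Czs : C (z s) by have := Cz (leq0n L); rewrite addn0.
rewrite -[leRHS]opprB (separable_replace partP hsep _ _ vP) same.
rewrite -(separable_replace partP hsep _ _ vP).
have := drift_sweep_max (ltnW jL) Czs.
have := drift_sweep_max (ltnW jL) (CP vP Czs Cy).
rewrite !ler_norml; lra.
Qed.

Lemma sweep_blocks y : (0 < L)%N -> C y ->
  (forall v, v \in P -> exists2 j, (j < L)%N & u (s + j) = v) ->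
  F (s + L) (z (s + L)%N) <= F s (z s) - beta * (F s (z s) - F s y) +
    L%:R * (e + d) + 2 * beta * #|P|%:R * (L%:R * d).
Proof.
move=> L0 Cy visit.
(* [V] is the set of blocks updated so far; the others are unchanged. *)
have inv j : (j <= L)%N -> exists V : {set {set 'I_n}}, [/\ V \subset P,
    forall i, (i < j)%N -> u (s + i) \in V,
    forall v, v \in P -> v \notin V -> subvec v (z (s + j)%N) = subvec v (z s)
  & F (s + j) (z (s + j)%N) <= F s (z s) - beta * (\sum_(v in V)
      (F s (z s) - F s (z s + keep v (y - z s)) - 2 * (L%:R * d))) +
      j%:R * (e + d)].
  elim: j => [_ | j IH jL].
    exists finset.set0; rewrite addn0 big_set0 mulr0 subr0 mul0r addr0.
    by split=> //; apply: finset.sub0set.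
  have [V [VP Vu Vz VF]] := IH (ltnW jL).
  have [a za] := upd jL.
  exists (u (s + j)%N |: V)%SET; split.
  - by rewrite finset.subUset finset.sub1set uP.
  - move=> i; rewrite ltnS leq_eqVlt => /orP[/eqP -> | ij].
      exact: finset.setU11.
    by apply: finset.setU1r; apply: Vu.
  - move=> v vP; rewrite finset.in_setU1 negb_or => /andP[vu vV].
    rewrite addnS za subvecD subvec_keep_disjoint ?addr0 ?Vz //.
    by rewrite (partition_disjoint partP) ?uP // eq_sym.
  (* A repeated update is credited with no new decrease, only with the monotone bound. *)
  have [uV | uV] := boolP (u (s + j)%N \in V).
    rewrite (finset.setUidPr _) ?finset.sub1set //.
    by have := step_mono jL; rewrite -natr1; lra.
  rewrite finset.big_setU1 //= -natr1.
  (* At its first update a block still has its value from time [s], so its initial gap is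
     collected. *)
  have := block_gap_drift jL (uP jL) Cy (Vz _ (uP jL) uV).
  move=> /(ler_wpM2l beta0); have := step_drift jL Cy; lra.
have [V [VP Vu _]] := inv L (leqnn L).
have -> : V = P.
  apply/eqP; rewrite finset.eqEsubset VP; apply/fintype.subsetP => v vP.
  by have [j jL <-] := visit v vP; apply: Vu.
have -> : \sum_(v in P) (F s (z s) - F s (z s + keep v (y - z s)) -
    2 * (L%:R * d)) = F s (z s) - F s y - #|P|%:R * (2 * (L%:R * d)).
  rewrite sumrB sumr_const -[_ *+ #|P|]mulr_natl; congr (_ - _).
  have [hu] := sep L0; rewrite addn0 => hsep.
  exact: (separable_sum partP hsep).
lra.
Qed.

End Sweep.

(** The recursion has fixed point [c < B]: values at most [B] stay there, and a value above [B] is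
    followed by a drop of at least [q = b * (B - c)]. *)
Lemma contraction_eventually_le {R : realType} (a : nat -> R) b c B :
  0 < b -> b <= 1 -> c < B ->
  (forall i, (1 <= i)%N -> a i.+1 <= (1 - b) * a i + b * c) ->
  exists I, forall i, (I < i)%N -> a i <= B.
Proof.
move=> b0 b1 cB rec; set q := b * (B - c).
have q0 : 0 < q by rewrite mulr_gt0 // subr_gt0.
have claim j : a j.+1 <= B \/ a j.+1 <= a 1%N - j%:R * q.
  elim: j => [|j IH]; first by right; rewrite mul0r subr0.
  have := rec j.+1 isT.
  have b1' : 0 <= 1 - b by rewrite subr_ge0.
  have [aB | Ba] := leP (a j.+1) B => recj.
    left; have := ler_wpM2l b1' aB; rewrite /q in q0; nra.
  right; case: IH => [|IH]; first by rewrite leNgt Ba.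
  have := ler_wpM2l (ltW b0) (ltW Ba); rewrite -natr1 /q in IH *; lra.
(* After [(a 1 - B) / q] steps the linear decrease reaches [B] too; the absolute value is there
   because the Archimedean bound asks for a nonnegative argument. *)
exists (Num.bound `|(a 1%N - B) / q|) => -[//|j] Ij.
case: (claim j) => // /le_trans; apply.
have := ltW (archi_boundP (normr_ge0 ((a 1%N - B) / q))).
move=> /(le_trans (ler_norm _)); rewrite ler_pdivrMr // => le1.
have : (Num.bound `|(a 1%N - B) / q|)%:R * q <= j%:R * q.
  by rewrite ler_wpM2r ?(ltW q0) // ler_nat.
lra.
Qed.

(** The product form in the second bound also covers [r = 0], where the quotient is [+oo] and only
    the first bound has content. *)
Lemma step_size_bounds {R : realType} (beta c eps r : R) :
  0 < c -> 0 < eps -> 0 <= r ->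
  (beta%:E <= c%:E * Order.min (eps%:E / r%:E) 1)%E ->
  beta <= c /\ r * beta <= c * eps.
Proof.
move=> c0 eps0 r0 le_min.
have le_of (t : R) : (Order.min (eps%:E / r%:E) 1 <= t%:E)%E -> beta <= c * t.
  move=> le_t; rewrite -lee_fin EFinM (le_trans le_min) //.
  by rewrite lee_pmul2l // lte_fin.
split; first by rewrite -[c]mulr1 le_of // ge_min lexx orbT.
have [-> | rn0] := eqVneq r 0; first by rewrite mul0r mulr_ge0 // ltW.
have rpos : 0 < r by rewrite lt_neqAle eq_sym rn0.
rewrite mulrC -ler_pdivlMr // -mulrA le_of // inver (negPf rn0) -EFinM.
by rewrite ge_min lexx.
Qed.

(* All sequences are indexed by k >= 1; their value at 0 is irrelevant. *)
Theorem theorem1 (R : realType) (n : nat) (U : {set {set 'I_n}})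
    (u : nat -> {set 'I_n}) (K : nat -> nat) (N : nat)
    (D : set 'rV[R]_n)
    (F : nat -> 'rV[R]_n -> R)
    (Fu : nat -> forall v : {set 'I_n}, 'rV[R]_#|v| -> R)
    (muF beta gamma gamma1 eps' xbarD : R)
    (x z ystar : nat -> 'rV[R]_n) :
  let C := conv_hull D in
  admissible U ->
  (forall k, (1 <= k)%N -> u k \in U) ->
  (* the intervals {K i, ..., K i.+1 - 1}, i >= 1, partition {1, 2, ...} *)
  K 1%N = 1%N ->
  (forall i, (1 <= i)%N -> (K i < K i.+1)%N) ->
  (forall i, (1 <= i)%N ->
     (\bigcup_(K i <= k < K i.+1) u k)%SET = fullset n) ->
  is_max [set (K j.+1 - K j + 1)%N | j in [set j | (1 <= j)%N]] N ->
  U_feasible U D ->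
  compact D ->
  (forall k, (1 <= k)%N ->
     convex_function [set: 'rV[R]_n] (F k) /\ U_separable U (F k) (Fu k)) ->
  (forall k v, (1 <= k)%N -> v \in U ->
     convex_function [set: 'rV[R]_#|v|] (Fu k v) /\
     bounded_curvature (Fu k v) (subvec v @` C) muF) ->
  0 < beta ->
  C (z 1%N) ->
  (forall k, (1 <= k)%N ->
     argmin D (fun w => Fu k (u k) (subvec (u k) (z k) +
                 beta *: (subvec (u k) w - subvec (u k) (z k)))) (x k)) ->
  (forall k, (1 <= k)%N ->
     z k.+1 = z k + beta *: keep (u k) (x k - z k)) ->
  0 < gamma < 1 ->
  0 < eps' ->
  is_max [set norm2 (p.1 - p.2) | p in C `*` C] xbarD ->
  (* in \bar R, division by 0 gives +oo *)
  (beta%:E <= ((1 - gamma) * gamma)%:E *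
     Order.min (eps'%:E / (N%:R * muF * xbarD ^+ 2)%:E) 1)%E ->
  0 < gamma1 < gamma / 2 ->
  (forall k w, (1 <= k)%N -> C w ->
     `|F k.+1 w - F k w| <= gamma1 * gamma / (2 * N%:R) * beta * eps') ->
  (forall k, (1 <= k)%N -> argmin C (F k) (ystar k)) ->
  exists M : nat, forall i, (1 <= i)%N -> (M <= K i)%N ->
    F (K i) (z (K i)) - F (K i) (ystar (K i)) <= (#|U| + 1)%:R * eps'.
Proof.
move=> C admU uU K1 Kinc Kcov [_ Nmax] feasU _ sepF curvF beta0 Cz1 xmin zrec.
move=> /andP[gam0 gam1] eps0 [_ diam] betale /andP[gam10 gam1lt] driftF ymin.
(* In dimension 0 there is a single point, so the gap vanishes. In positive dimension the full set
   is nonempty and can be a block of a partition. *)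
case: n => [|n] in U u D F Fu x z ystar C admU uU Kcov feasU sepF curvF Cz1
  xmin zrec diam driftF ymin *.
  exists 0%N => i _ _.
  have -> : z (K i) = ystar (K i) by apply/rowP => -[].
  by rewrite subrr mulr_ge0 // ltW.
have [P partP UP] := admU.
have PU : P \subset U.
  by case: UP => ->; rewrite ?finset.subsetUr.
have diamX y w : C y -> C w -> norm2 (y - w) <= xbarD.
  by move=> Cy Cw; apply: diam; exists (y, w).
have X0 : 0 <= xbarD := le_trans (norm2_ge0 _) (diamX _ _ Cz1 Cz1).
have u1U := uU 1%N isT.
have mu0 : 0 <= muF by have [_ []] := curvF 1%N _ isT u1U.
have m1 : 1 <= #|U|%:R :> R.
  by rewrite ler1n card_gt0; apply/finset.set0Pn; exists (u 1%N).
have c0 : 0 < (1 - gamma) * gamma by rewrite mulr_gt0 // subr_gt0.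
have [betac betaN] : beta <= (1 - gamma) * gamma /\
    (N%:R * muF * xbarD ^+ 2) * beta <= (1 - gamma) * gamma * eps'.
  by apply: step_size_bounds; rewrite // !mulr_ge0 ?sqr_ge0.
have beta1 : beta <= 1 by nra.
(* Feasibility speaks of [b] in [D]; the replacement is affine in [b], so it extends to the hull. *)
have Ckeep v a b : v \in U -> C a -> C b -> C (a + keep v (b - a)).
  move=> vU Ca; move: b; apply: conv_hull_ind => [b Db | b1 b2 t t0 t1 C1 C2].
    exact: feasU.
  have -> : a + keep v (t *: b1 + (1 - t) *: b2 - a) =
      t *: (a + keep v (b1 - a)) + (1 - t) *: (a + keep v (b2 - a)).
    by apply/rowP => i; rewrite !mxE; case: ifP => _; ring.
  exact: conv_hull_convex.
have Dx k : (1 <= k)%N -> C (x k).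
  by move=> k1; apply: sub_conv_hull; have [] := xmin k k1.
have Cz k : (1 <= k)%N -> C (z k).
  case: k => // k _; elim: k => [//|k IH].
  have -> : z k.+2 = beta *: (z k.+1 + keep (u k.+1) (x k.+1 - z k.+1)) +
      (1 - beta) *: z k.+1.
    by rewrite zrec //; apply/rowP => i; rewrite !mxE; ring.
  apply: conv_hull_convex => //; first exact: ltW.
  by apply: Ckeep; rewrite ?uU //; apply: Dx.
have partition_full : finset.partition [set fullset n.+1]%SET (fullset n.+1).
  apply/and3P; split.
  - by rewrite /finset.cover finset.big_set1.
  - apply/finset.trivIsetP => A B /finset.set1P -> /finset.set1P ->.
    by rewrite eqxx.
  - rewrite finset.in_set1 eq_sym; apply/finset.set0Pn; exists ord0.
    exact: finset.in_setT.
(* Every update set is a block of some partition inside [U], the full set possibly of the one-block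
   partition; thus full and partial updates share one step estimate. *)
have in_partition v : v \in U -> exists Q : {set {set 'I_n.+1}},
    [/\ Q \subset U, finset.partition Q (fullset n.+1) & v \in Q].
  move=> vU; have [vP | vP] := boolP (v \in P); first by exists P.
  case: UP => UE; first by rewrite -UE vU in vP.
  move: (vU); rewrite UE finset.in_setU1 (negPf vP) orbF => /eqP vE.
  exists [set fullset n.+1]%SET; split=> //; last by rewrite vE finset.set11.
  by rewrite finset.sub1set -vE finset.setU11.
set e := muF * beta ^+ 2 * xbarD ^+ 2.
set d := gamma1 * gamma / (2 * N%:R) * beta * eps'.
have e0 : 0 <= e by rewrite !mulr_ge0 // ltW.
have d0 : 0 <= d. by rewrite !mulr_ge0 ?invr_ge0 ?mulr_ge0 // ltW.
have step k w : (1 <= k)%N -> C w -> F k (z k.+1) - F k (z k) <=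
    beta * (F k (z k + keep (u k) (w - z k)) - F k (z k)) + e.
  move=> k1 Cw; have [Q [QU partQ uQ]] := in_partition _ (uU k k1).
  have [_ sep] := sepF k k1; have {}sep := sep Q QU partQ.
  have [_ curv] := curvF k _ k1 (uU k k1).
  have := block_step diamX curv (ltW beta0) beta1 (Cz k k1) Cw (xmin k k1).
  rewrite (separable_replace partQ sep) //.
  (* The damped update is a plain block replacement towards [z k + beta *: (x k - z k)]. *)
  have -> : z k.+1 = z k + keep (u k) ((z k + beta *: (x k - z k)) - z k).
    by rewrite zrec // [_ + _ - z k]addrAC subrr add0r keepZ.
  by rewrite (separable_replace partQ sep) // subvecD subvecZ subvecB.
pose gap i := F (K i) (z (K i)) - F (K i) (ystar (K i)).
have Kge i : (1 <= i)%N -> (i <= K i)%N.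
  case: i => // i _; elim: i => [|i IH]; first by rewrite K1.
  exact: leq_ltn_trans IH (Kinc _ _).
have sweep i : (1 <= i)%N -> gap i.+1 <= (1 - beta) * gap i +
    (K i.+1 - K i)%:R * e + 2 * (K i.+1 - K i)%:R * d +
    2 * beta * #|U|%:R * ((K i.+1 - K i)%:R * d).
  move=> i1; set s := K i; set L := (K i.+1 - s)%N.
  have s1 : (1 <= s)%N := leq_trans i1 (Kge i i1).
  have L0 : (0 < L)%N by rewrite subn_gt0 Kinc.
  have sL : (s + L)%N = K i.+1 by rewrite subnKC // ltnW // Kinc.
  have sj j : (1 <= s + j)%N := leq_trans s1 (leq_addr _ _).
  have [Cys ys] := ymin s s1.
  have [Cye _] := ymin (s + L)%N (sj L).
  have Czs j : (j <= L)%N -> C (z (s + j)%N) by move=> _; apply: Cz.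
  have drifts j w : (j < L)%N -> C w -> `|F (s + j).+1 w - F (s + j) w| <= d.
    by move=> _; apply: driftF.
  have steps j w (_ : (j < L)%N) := step (s + j)%N w (sj j).
  have Ld0 : 0 <= L%:R * d by rewrite mulr_ge0.
  have end_le : F (s + L) (z (s + L)%N) <= F s (z s) -
      beta * (F s (z s) - F s (ystar s)) + L%:R * (e + d) +
      2 * beta * #|U|%:R * (L%:R * d).
    have [/existsP[j /eqP uj] | nofull] :=
        boolP [exists j : 'I_L, u (s + j)%N == fullset n.+1].
      have full : exists2 j, (j < L)%N & u (s + j)%N = fullset n.+1 by exists j.
      have := sweep_full (ltW beta0) beta1 e0 d0 Czs steps drifts Cys full.
      (* The loss [beta * (L%:R * d)] of a full sweep fits into the block bound because [U] has at
         least one element. *)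
      have := ler_wpM2l (mulr_ge0 (ltW beta0) Ld0) m1.
      have := mulr_ge0 (ltW beta0) Ld0; lra.
    have uP j : (j < L)%N -> u (s + j)%N \in P.
      move=> jL; have := uU _ (sj j); case: UP => -> //.
      rewrite finset.in_setU1 => /orP[uf|//].
      by case/existsP: nofull; exists (Ordinal jL).
    have visit v : v \in P -> exists2 j, (j < L)%N & u (s + j)%N = v.
      move=> vP; case/and3P: (partP) => _ _ P0.
      (* A point [a] of the nonempty block [v] is covered by some [u k]; two blocks sharing [a]
         coincide. *)
      have /finset.set0Pn[a av] : v != finset.set0.
        by apply: contraNneq P0 => <-.
      have : a \in fullset n.+1 by exact: finset.in_setT.
      rewrite -(Kcov i i1) big_tnth => /finset.bigcupP[r _].
      set k := tnth _ r => auk.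
      have : k \in index_iota (K i) (K i.+1) := mem_tnth r (in_tuple _).
      rewrite mem_index_iota => /andP[sk ke].
      have jL : (k - s < L)%N by rewrite ltn_sub2r // Kinc.
      exists (k - s)%N => //; rewrite subnKC //.
      apply/eqP/negPn/negP => uv.
      have ukP : u k \in P by rewrite -(subnKC sk) uP.
      by have := disjointFr (partition_disjoint partP ukP vP uv) auk; rewrite av.
    apply: le_trans (sweep_blocks (ltW beta0) d0 Czs steps drifts partP
      _ _ _ uP L0 Cys visit) _.
    - move=> j _; exists (Fu (s + j)%N) => a.
      by have [_ sep] := sepF _ (sj j); apply: sep.
    - by move=> v a b vP; apply: Ckeep; apply: (fintype.subsetP PU).
    - by move=> j _; eexists; rewrite zrec // -keepZ.
    have : #|P|%:R <= #|U|%:R :> R by rewrite ler_nat subset_leq_card.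
    move=> /(ler_wpM2l (mulr_ge0 (ltW beta0) Ld0)); lra.
  (* Since [ystar s] minimizes [F s], the minimal value drops by at most [L%:R * d] over the sweep;
     this is the second copy of that term. *)
  have := ys _ Cye.
  have := drift_sweep_max d0 drifts (leqnn L) Cye; rewrite ler_norml => /andP[].
  rewrite /gap -sL; lra.
(* The three summands bound, in units of [beta * eps'], the curvature error, the drift [2 L d] and
   the block drift [2 beta |U| L d]. *)
pose B := (1 - gamma) * gamma + gamma1 * gamma + beta * #|U|%:R * (gamma1 * gamma).
(* [N] bounds the interval length plus one; only the weaker bound on the length is kept. *)
have N2 i : (1 <= i)%N -> (K i.+1 - K i)%:R <= N%:R :> R.
  move=> i1; rewrite ler_nat (leq_trans (leq_addr 1 _)) //.
  by apply: Nmax; exists i.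
have Npos : 0 < N%:R :> R.
  rewrite ltr0n; apply: leq_trans (Nmax (K 2 - K 1 + 1)%N _); first by rewrite addn1.
  by exists 1%N.
have Nd : 2 * (N%:R * d) = gamma1 * gamma * beta * eps'.
  by rewrite /d; field; rewrite gt_eqF.
have Ne : N%:R * e <= beta * ((1 - gamma) * gamma * eps').
  apply: le_trans (ler_wpM2l (ltW beta0) betaN); rewrite /e; lra.
have rec i : (1 <= i)%N -> gap i.+1 <= (1 - beta) * gap i + beta * (B * eps').
  move=> i1; apply: le_trans (sweep i i1) _.
  have Le := ler_wpM2r e0 (N2 i i1).
  have Ld := ler_wpM2r d0 (N2 i i1).
  have := ler_wpM2l (mulr_ge0 (ltW beta0) (ler0n R #|U|)) Ld.
  have : beta * #|U|%:R * (2 * (N%:R * d)) =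
      beta * #|U|%:R * (gamma1 * gamma * beta * eps') by rewrite Nd.
  rewrite /B; lra.
have BU : B * eps' < (#|U| + 1)%:R * eps'.
  rewrite ltr_pM2r // natrD.
  (* The last summand of [B] is at most [|U|], and the first two stay below 1 because
     [gamma1 < gamma / 2]. *)
  have g1g : gamma1 * gamma <= 1 by nra.
  have := ler_wpM2l (mulr_ge0 (ltW beta0) (ler0n R #|U|)) g1g.
  have := ler_wpM2r (ler0n R #|U|) beta1.
  rewrite /B; nra.
have [I HI] := contraction_eventually_le beta0 beta1 BU rec.
(* [K] is strictly increasing, so [K i >= K I.+1] forces [i > I]. *)
exists (K I.+1) => i i1 Ki; apply: HI; rewrite ltnNge; apply/negP => iI.
have Kmono j : (i <= j)%N -> (K i < K j.+1)%N.
  elim: j => [|j IH]; first by rewrite leqn0 => /eqP i0; rewrite i0 in i1.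
  rewrite leq_eqVlt => /orP[/eqP -> | ij]; first exact: Kinc.
  exact: ltn_trans (IH ij) (Kinc _ _).
by have := Kmono I iI; rewrite ltnNge Ki.
Qed.
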